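(* Let $X$ be a continuous random variable with $\mathrm{Supp}(X)\subseteq[a,b]$, let $\mathbf{Z}$ be a random vector, let $Y=g(X,\mathbf{Z})$ with interventional function $g_{in}$, let $\mathbf{z}$ be a value of $\mathbf{Z}$, and let $d\ge0$. Assume that $g_{in}$ has continuous partial derivative with respect to $x$. Then for each $\epsilon\in\{+,-\}$, $$\mathrm{PIEV}_d^{\mathbf{z}}(X\to Y)^{\epsilon}=\int_a^b\left(\frac{\partial g_{in}}{\partial x}(t,\mathbf{z})\right)^{\epsilon}f^{2d}(t|\mathbf{z})\,\mathrm{d}t.$$
   Context: $f(\cdot|\mathbf{z})$ is the probability density function of $X$ given $\mathbf{Z}=\mathbf{z}$. For $r\in\mathbb{R}$, $r^{+}=\max\{r,0\}$ and $r^{-}=|r|-r^{+}$. The interventional function $g_{in}$ is obtained from $g$ by removing all functional relationships defining $X$ and $\mathbf{Z}$, so that its arguments $x$ and $\mathbf{z}$ vary independently. A partition $P$ of $[a,b]$ is a chain $a=x_0^{(P)}<x_1^{(P)}<\dots<x_{n_P}^{(P)}=b$, with mesh $\|P\|=\max_i(x_i^{(P)}-x_{i-1}^{(P)})$. Define $$L_{P,d}^{\mathbf{z}}(X\to Y)^{\epsilon}:=\sum_{i=1}^{n_P}\Bigl(g_{in}(x_i^{(P)},\mathbf{z})-g_{in}(x_{i-1}^{(P)},\mathbf{z})\Bigr)^{\epsilon}f(x_i^{(P)}|\mathbf{z})^d f(x_{i-1}^{(P)}|\mathbf{z})^d,$$ $$\mathrm{PIEV}_d^{\mathbf{z}}(X\to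 Y)^{\epsilon}:=\lim_{\|P\|\to0}L_{P,d}^{\mathbf{z}}(X\to Y)^{\epsilon},$$ the limit being over partitions $P$ of $[a,b]$.
   Formalization: For d > 0 the conditional density f(·|z) is additionally assumed bounded and almost everywhere continuous on [a,b] (Riemann integrable); without this the limit can fail, e.g. for f(x)=x^{-1/2}/2 on (0,1], g_in = x, d = 1/2. *)

(* Defs.v *)
From HB Require Import structures.
From mathcomp Require Import all_boot all_order all_algebra.
From mathcomp Require Import all_classical all_reals all_analysis.

Set Implicit Arguments.
Unset Strict Implicit.
Unset Printing Implicit Defensive.

Import Order.TTheory GRing.Theory Num.Theory.
Import numFieldNormedType.Exports.
Local Open Scope classical_set_scope.
Local Open Scope ring_scope.

Inductive sign := Plus | Minus.

Definition signed_part (R : realType) (eps : sign) (r : R) : R :=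
  match eps with
  | Plus => Num.max r 0
  | Minus => `|r| - Num.max r 0
  end.

Section random_variables.
Context (disp : measure_display) (Omega : measurableType disp) (R : realType).
Context (P : probability Omega R).

Definition rv_support (X : {RV P >-> R}) : set R :=
  [set x | forall U : set R, open U -> U x -> (0 < P (X @^-1` U))%E].

Definition continuous_rv (X : {RV P >-> R}) : Prop :=
  distribution P X `<< (@lebesgue_measure R).

(* [f x z] is f(x|z).  The law of [Z] is arbitrary (discrete, continuous or
   mixed), so the conditional density is specified by disintegrating the joint
   law of [(X, Z)] along the law of [Z]. *)
Definition conditional_pdf (k : nat) (X : {RV P >-> R})
    (Z : {RV P >-> k.-tuple R}) (f : R -> k.-tuple R -> R) : Prop :=
  [/\ measurable_fun [set: R * k.-tuple R] (fun p => f p.1 p.2),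
      (forall x z, 0 <= f x z),
      (forall z, range Z z -> (\int[lebesgue_measure]_x (f x z)%:E = 1)%E) &
      forall (A : set R) (B : set (k.-tuple R)), measurable A -> measurable B ->
        (P (X @^-1` A `&` Z @^-1` B) =
         \int[distribution P Z]_(z in B)
           \int[lebesgue_measure]_(x in A) (f x z)%:E)%E].

(* In [g (X w) (Z w)] the two arguments are tied together by the relationships
   defining [X] and [Z]; [g_in] takes independent arguments and gives the same
   value at every pair that is actually attained. *)
Definition interventional_of (k : nat) (X : {RV P >-> R})
    (Z : {RV P >-> k.-tuple R}) (g g_in : R -> k.-tuple R -> R) : Prop :=
  forall w, g_in (X w) (Z w) = g (X w) (Z w).

End random_variables.

Section piev.
Context (R : realType).

Definition partial_x (T : Type) (g : R -> T -> R) (x : R) (z : T) : R :=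
  derive1 (fun t => g t z) x.

(* As in [itv_partition a b s], the partition a = x_0 < x_1 < ... < x_n = b is
   encoded by the sequence [s] of x_1, ..., x_n, with n = [size s]. *)
Definition node (a : R) (s : seq R) (i : nat) : R := nth a (a :: s) i.

Definition mesh (a : R) (s : seq R) : R :=
  \big[Num.max/0]_(i < size s) (node a s i.+1 - node a s i).

Definition mesh_to0 (a b : R) : set_system (seq R) :=
  [set S | exists2 delta : R, 0 < delta &
     forall s, itv_partition a b s -> mesh a s < delta -> S s].

(* [powR] satisfies 0 `^ 0 = 1, so the density plays no role when [d = 0]. *)
Definition L_sum (T : Type) (g_in f : R -> T -> R) (d a : R) (z : T)
    (eps : sign) (s : seq R) : R :=
  \sum_(i < size s)
    signed_part eps (g_in (node a s i.+1) z - g_in (node a s i) z)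
    * f (node a s i.+1) z `^ d * f (node a s i) z `^ d.

Definition PIEV (T : Type) (g_in f : R -> T -> R) (d a b : R) (z : T)
    (eps : sign) : R :=
  lim (L_sum g_in f d a z eps s @[s --> mesh_to0 a b]).

(* Riemann integrability on [a, b], in Lebesgue's form. *)
Definition bounded_ae_continuous (a b : R) (h : R -> R) : Prop :=
  (exists M : R, forall x, x \in `[a, b] -> `|h x| <= M) /\
  {ae (@lebesgue_measure R), forall x, x \in `[a, b] -> {for x, continuous h}}.

End piev.

(* Main.v *)
(* By the mean value theorem each increment of [g_in] over a cell is the
   derivative at an interior point times the cell length, and both signed parts
   are positively homogeneous.  So the sum over a partition is the integral of a
   step function.  As the mesh tends to 0 these step functions stay bounded and
   converge to the integrand at every point of [a, b] where the density is
   continuous, hence almost everywhere, and dominated convergence applies. *)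
Require Import Defs.
From HB Require Import structures.
From mathcomp Require Import all_boot all_order all_algebra.
From mathcomp Require Import all_classical all_reals all_analysis.
From mathcomp Require Import measurable_realfun ring lra.

Import Order.TTheory GRing.Theory Num.Theory.
Import numFieldNormedType.Exports.
Local Open Scope classical_set_scope.
Local Open Scope ring_scope.

(** * Signed parts and real powers *)

Lemma ae_lebesgueS {R : realType} (P Q : R -> Prop) :
  (forall x, P x -> Q x) ->
  {ae (@lebesgue_measure R), forall x, P x} ->
  {ae (@lebesgue_measure R), forall x, Q x}.
Proof.
by move=> PQ; apply: negligibleS => x /=; exact: contra_not (PQ x).
Qed.

(** Treating both signs by one formula reduces homogeneity, continuity and measurability to those of
    the norm and of [r] or [- r]. *)
Lemma signed_partE (R : realType) (eps : sign) (r : R) :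
  signed_part eps r = (`|r| + (if eps is Plus then r else - r)) / 2.
Proof.
by case: eps => /=; rewrite maxr_absE subr0 addr0; field.
Qed.

Lemma signed_partM (R : realType) (eps : sign) (r c : R) :
  0 <= c -> signed_part eps (r * c) = signed_part eps r * c.
Proof.
by move=> c0; rewrite !signed_partE normrM (ger0_norm c0); case: eps; field.
Qed.

Lemma norm_signed_part_le (R : realType) (eps : sign) (r : R) :
  `|signed_part eps r| <= `|r|.
Proof.
have := ler_norm r; have := lerNnormlW (lexx `|r|).
by rewrite signed_partE => *; rewrite ger0_norm; case: eps; lra.
Qed.

Lemma cvg_signed_part (R : realType) (T : Type) (F : set_system T)
    (FF : Filter F) (eps : sign) (u : T -> R) (l : R) :
  u x @[x --> F] --> l ->
  signed_part eps (u x) @[x --> F] --> signed_part eps l.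
Proof.
move=> ul; under eq_fun do rewrite signed_partE.
rewrite signed_partE; apply: cvgMl; apply: cvgD; first exact: cvg_norm.
by case: eps => //; exact: cvgN.
Qed.

Lemma measurable_signed_part (R : realType) (D : set R) (eps : sign)
    (u : R -> R) : measurable_fun D u ->
  measurable_fun D (fun x => signed_part eps (u x)).
Proof.
move=> mu; under eq_fun do rewrite signed_partE.
apply: measurable_funM => //; apply: measurable_funD.
  exact: measurableT_comp.
by case: eps => //; exact: measurableT_comp.
Qed.

(** Three regimes: for [d = 0] the power is constantly 1, even at base 0; for [l = 0] a direct
    estimate works; for [l > 0] the power is the continuous function [expR (d * ln x)] near [l]. *)
Lemma cvg_powR_base (R : realType) (T : Type) (F : set_system T)
    (FF : Filter F) (u : T -> R) (l d : R) :
  0 <= d -> 0 <= l -> (forall x, 0 <= u x) ->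
  u x @[x --> F] --> l -> u x `^ d @[x --> F] --> l `^ d.
Proof.
rewrite le_eqVlt => /predU1P[<- _ _ _|d0].
  under eq_fun do rewrite powRr0.
  by rewrite powRr0; exact: cvg_cst.
rewrite le_eqVlt => /predU1P[<- u0 ul|l0 u0 ul].
  rewrite powR0 ?gt_eqF//; apply/cvgrPdist_lt => e e0.
  (* The tolerance on [u] is the [d]-th root of [e], so that raising to the power [d] gives back
     [e]. *)
  have e'0 : 0 < e `^ d^-1 by exact: powR_gt0.
  move/cvgrPdist_lt : ul => /(_ _ e'0); apply: filterS => x.
  rewrite !sub0r !normrN !ger0_norm ?powR_ge0// => uxe.
  have -> : e = (e `^ d^-1) `^ d.
    by rewrite -powRrM mulVf ?gt_eqF// powRr1// ltW.
  by rewrite gt0_ltr_powR// nnegrE// ltW.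
have ce : {for l, continuous (fun x : R => expR (d * ln x))}.
  apply: continuous_comp; last exact: continuous_expR.
  by apply: cvgMr; exact: continuous_ln.
have := @cvg_comp _ _ _ u (fun x : R => expR (d * ln x)) F _ _ ul ce.
have -> : l `^ d = expR (d * ln l) by rewrite /powR gt_eqF.
apply: cvg_trans.
(* [powR] is defined by cases at base 0; the exponential formula is valid where [u] is positive,
   which holds eventually since [l] is. *)
apply: near_eq_cvg; apply: filterS (@cvgr_gt _ _ _ _ _ _ ul _ l0) => x ux.
by rewrite /= /powR gt_eqF.
Qed.

(** * Nodes, cells and uniform partitions *)

Section partition_nodes.
Context {R : realType}.
Implicit Types (a b : R) (s : seq R).

Lemma node_lt {a b s i j} : itv_partition a b s ->
  (i < j)%N -> (j <= size s)%N -> node a s i < node a s j.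
Proof.
move=> [pas _] ij js.
have := @sorted_ltn_nth _ _ lt_trans a (a :: s) pas i j.
by rewrite !inE /= !ltnS; apply => //; exact: leq_trans (ltnW ij) js.
Qed.

Lemma node_le {a b s i j} : itv_partition a b s ->
  (i <= j)%N -> (j <= size s)%N -> node a s i <= node a s j.
Proof.
move=> pas; rewrite leq_eqVlt => /predU1P[->//|ij js].
by rewrite ltW// (node_lt pas).
Qed.

Lemma node_size {a b s} : itv_partition a b s -> node a s (size s) = b.
Proof. exact: itv_partition_nth_size. Qed.

Lemma node_ge {a b s i} : itv_partition a b s ->
  (i <= size s)%N -> a <= node a s i.
Proof. by move=> pas si; exact: (node_le (i := 0) pas). Qed.

Lemma node_le_right {a b s i} : itv_partition a b s ->
  (i <= size s)%N -> node a s i <= b.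
Proof. by move=> pas si; rewrite -[leRHS](node_size pas) (node_le pas). Qed.

Lemma node_step_le_mesh {a s i} : (i < size s)%N ->
  node a s i.+1 - node a s i <= mesh a s.
Proof.
move=> si; exact: (le_bigmax 0
  (fun i : 'I_(size s) => node a s i.+1 - node a s i) (Ordinal si)).
Qed.

Lemma node_cell {a b s t} : itv_partition a b s -> a < t -> t <= b ->
  exists2 i, (i < size s)%N & node a s i < t <= node a s i.+1.
Proof.
move=> pas lt_at tb; pose p := [pred i | t <= node a s i].
(* The right end of the cell is the first node not below [t]; its index is not 0 because [a < t]. *)
have exp : exists i, p i by exists (size s); rewrite inE /= (node_size pas).
case: (ex_minnP exp) => -[|i] pi mini.
  by move: pi; rewrite inE /= leNgt lt_at.
exists i; first by apply: mini; rewrite inE /= (node_size pas).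
apply/andP; split => //; rewrite ltNge; apply/negP => /mini.
by rewrite ltnn.
Qed.

Lemma uniform_partition {a b} {delta : R} : a < b -> 0 < delta ->
  exists2 s, itv_partition a b s & mesh a s < delta.
Proof.
(* Truncation plus one strictly exceeds [(b - a) / delta], so [n] equal cells are each shorter than
   [delta]. *)
move=> ab delta0; pose n := (Num.truncn ((b - a) / delta)).+1.
have n0 : 0 < n%:R :> R by rewrite ltr0n.
have nE : (b - a) / n%:R < delta.
  rewrite ltr_pdivrMr// -ltr_pdivrMl// mulrC.
  by rewrite truncnS_gt.
pose x i := a + (b - a) / n%:R * i%:R.
have nodeE i : (i <= n)%N -> node a (mkseq (x \o succn) n) i = x i.
  case: i => [|i] ile; first by rewrite /x mulr0 addr0.
  by rewrite /node/= nth_mkseq.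
have xS i : x i.+1 - x i = (b - a) / n%:R.
  by rewrite /x -natr1; ring.
exists (mkseq (x \o succn) n).
  split.
    apply/(pathP a) => i; rewrite size_mkseq => il.
    have := nodeE _ (ltnW il); rewrite /node => ->; rewrite nth_mkseq//=.
    by rewrite -subr_gt0 xS divr_gt0// subr_gt0.
  rewrite (last_nth a) size_mkseq; have := nodeE _ (leqnn n).
  by rewrite /node => ->; rewrite /x divfK ?lt0r_neq0// addrC subrK.
apply: bigmax_lt => // -[i il] _ /=; move: il; rewrite size_mkseq => il.
by rewrite !nodeE ?xS// ltnW.
Qed.

End partition_nodes.

(** * Filters of fine partitions and of shrinking cells *)

Instance mesh_to0_filter (R : realType) (a b : R) : Filter (mesh_to0 a b).
Proof.
split.
- by exists 1.
- move=> S S' [e e0 Se] [e' e'0 Se']; exists (Num.min e e').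
    by rewrite lt_min e0.
  move=> s ps; rewrite lt_min => /andP[se se'].
  by split; [exact: Se|exact: Se'].
- by move=> S S' SS' [e e0 Se]; exists e => // s ps se; exact/SS'/Se.
Qed.

(** Properness makes limits along the mesh unique, which is what allows [lim] to be computed. *)
Lemma mesh_to0_proper (R : realType) (a b : R) : a < b ->
  ProperFilter (mesh_to0 a b).
Proof.
move=> ab; split; last exact: mesh_to0_filter.
by case=> e e0 h; have [s ps se] := uniform_partition ab e0; exact: (h s ps se).
Qed.

(** Pairs [(u, v)] stand for cells []u, v]] around [t]; the strictness of the inequalities matches
    the half-open cells of the step functions. At [t = a] no such pair exists and every limit holds
    trivially. *)
Definition shrink_to {R : realType} (a b t : R) : set_system (R * R) :=
  filter_from [set e | 0 < e] (fun e => [set p |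
    [/\ a <= p.1, p.1 < t, t <= p.2, p.2 <= b & p.2 - p.1 < e]]).

Instance shrink_to_filter (R : realType) (a b t : R) :
  Filter (shrink_to a b t).
Proof.
apply: filter_from_filter; first by exists 1; exact: ltr01.
move=> e e' /= e0 e'0; exists (Num.min e e'); first by rewrite /= lt_min e0.
by move=> p /= [? ? ? ?]; rewrite lt_min => /andP[].
Qed.

(** * Step functions on partitions and the limit of their integrals *)

Section step_function.
Context {R : realType} (H : R -> R -> R) (a : R).
Local Notation mu := (@lebesgue_measure R).

(** The height on a cell depends on both of its ends, because each summand uses the density at both.
    Half-open cells tile []a, b]] without overlap. *)
Definition step_fun (s : seq R) (t : R) : R :=
  \sum_(i < size s) H (node a s i) (node a s i.+1) *
    \1_(`]node a s i, node a s i.+1]%classic) t.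

Lemma measurable_step_fun (s : seq R) (D : set R) :
  measurable_fun D (step_fun s).
Proof.
by apply: measurable_sum => i; exact: measurable_funM.
Qed.

Lemma step_funE {b s t} : itv_partition a b s -> a < t -> t <= b ->
  exists i, [/\ (i < size s)%N, node a s i < t <= node a s i.+1 &
    step_fun s t = H (node a s i) (node a s i.+1)].
Proof.
move=> pas lt_at tb; have [i si /andP[it ti]] := node_cell pas lt_at tb.
exists i; split; rewrite ?it// /step_fun (bigD1 (Ordinal si))//=.
rewrite indicE mem_set/= ?in_itv/= ?it// mulr1 big1 ?addr0// => -[j sj].
rewrite -val_eqE /= neq_ltn => jNi; rewrite indicE memNset ?mulr0//=.
(* A cell of smaller index ends before [t], and one of larger index starts at or after [t]. *)
rewrite in_itv/= => /andP[jt tj]; case/orP: jNi => ij.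
  by have := node_le pas ij (ltnW si); rewrite leNgt (lt_le_trans it).
by have := node_le pas ij (ltnW sj); rewrite leNgt (lt_le_trans jt).
Qed.

Lemma integral_step_fun {b s} : itv_partition a b s ->
  (\int[mu]_(t in `]a, b]) (step_fun s t)%:E =
   (\sum_(i < size s) H (node a s i) (node a s i.+1) *
      (node a s i.+1 - node a s i))%:E)%E.
Proof.
move=> pas; rewrite -sumEFin; under eq_integral => t _.
  rewrite /step_fun -sumEFin; under eq_bigr do rewrite EFinM.
  over.
have mD : measurable (`]a, b]%classic : set R) by exact: measurable_itv.
have finD : (mu `]a, b]%classic < +oo)%E.
  rewrite lebesgue_measure_itv/=; case: ifPn => // _.
  by rewrite -EFinB ltry.
have iI (i : 'I_(size s)) : mu.-integrable `]a, b]
    (fun t => (\1_(`]node a s i, node a s i.+1]%classic) t)%:E).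
  apply: measurable_bounded_integrable => //.
  exists 1; split => // x x1 t _ /=; rewrite indicE.
  by case: (_ \in _); rewrite ?normr1 ?normr0 ltW// (lt_trans ltr01).
rewrite integral_sum//; last first.
  by move=> i; exact: integrableZl.
apply: eq_bigr => i _; rewrite integralZl// integral_indic// EFinM.
congr (_ * _)%E.
rewrite setIidl.
  by rewrite [LHS]lebesgue_measure_itv/= lte_fin (node_lt pas).
move=> t /=; rewrite !in_itv/= => /andP[it ti]; apply/andP; split.
  by rewrite (le_lt_trans _ it)// (node_ge pas)// ltnW.
by rewrite (le_trans ti)// (node_le_right pas).
Qed.

Lemma step_fun_bounded {b M s t} :
  (forall u v, a <= u -> u < v -> v <= b -> `|H u v| <= M) ->
  itv_partition a b s -> t \in `]a, b] -> `|step_fun s t| <= M.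
Proof.
move=> HM pas; rewrite in_itv/= => /andP[lt_at tb].
have [i [si /andP[it ti] ->]] := step_funE pas lt_at tb.
by rewrite HM ?(lt_le_trans it)// ?(node_ge pas) ?(node_le_right pas)// ltnW.
Qed.

(** The value at [t] is [H] at the ends of the cell containing [t]; that cell is no longer than the
    mesh, so its ends follow [shrink_to a b t]. *)
Lemma cvg_step_fun {b t l : R} (s_ : nat -> seq R) :
  (forall n, itv_partition a b (s_ n)) -> mesh a (s_ n) @[n --> \oo] --> 0 ->
  H p.1 p.2 @[p --> shrink_to a b t] --> l -> t \in `]a, b] ->
  step_fun (s_ n) t @[n --> \oo] --> l.
Proof.
move=> ps mesh0 Hl; rewrite in_itv/= => /andP[lt_at tb].
apply/cvgrPdist_lt => e e0; move/cvgrPdist_lt : Hl => /(_ e e0)[delta d0 Hl].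
move/cvgrPdist_lt : mesh0 => /(_ delta d0); apply: filterS => n.
rewrite sub0r normrN => nd.
have [i [si /andP[it ti] ->]] := step_funE (ps n) lt_at tb.
apply: (Hl (_, _)); split => //=.
- exact: node_ge (ps n) (ltnW si).
- exact: node_le_right (ps n) si.
- apply: le_lt_trans nd; apply: le_trans (ler_norm _).
  exact: node_step_le_mesh.
Qed.

End step_function.

(* Dominated convergence needs sequences, hence the argument by contradiction
   along a sequence of partitions with mesh tending to 0. *)
Lemma interval_sums_cvg {R : realType} (H : R -> R -> R) (h : R -> R)
    (a b M : R) :
  a < b ->
  measurable_fun `[a, b] h ->
  (forall u v, a <= u -> u < v -> v <= b -> `|H u v| <= M) ->
  {ae (@lebesgue_measure R), forall t, t \in `[a, b] ->
    H p.1 p.2 @[p --> shrink_to a b t] --> h t} ->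
  \sum_(i < size s) H (node a s i) (node a s i.+1) *
    (node a s i.+1 - node a s i) @[s --> mesh_to0 a b] -->
  \int[lebesgue_measure]_(t in `[a, b]) h t.
Proof.
move=> ab mh HM Hh.
have sub_itv : `]a, b]%classic `<=` `[a, b]%classic.
  by move=> t /=; rewrite !in_itv/= => /andP[/ltW-> ->].
have dct (s_ : nat -> seq R) : (forall n, itv_partition a b (s_ n)) ->
    (forall n, mesh a (s_ n) < n.+1%:R^-1) ->
    lebesgue_measure.-integrable `]a, b] (EFin \o h) /\
    \sum_(i < size (s_ n)) H (node a (s_ n) i) (node a (s_ n) i.+1) *
      (node a (s_ n) i.+1 - node a (s_ n) i) @[n --> \oo] -->
    \int[lebesgue_measure]_(t in `]a, b]) h t.
  move=> ps mesh_lt.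
  have mesh0 : mesh a (s_ n) @[n --> \oo] --> 0.
    apply: (squeeze_cvgr _ (cvg_cst 0) cvg_harmonic).
    by apply: nearW => n; rewrite bigmax_ge_id/= ltW.
  have [|||||ih _] := @dominated_convergence _ _ _
      (@lebesgue_measure R) `]a, b]%classic (measurable_itv _)
      (fun n => EFin \o step_fun H a (s_ n)) (EFin \o h) (cst M%:E).
  - by move=> n; apply/measurable_EFinP; exact: measurable_step_fun.
  - by apply/measurable_EFinP; apply: measurable_funS mh.
  - apply: ae_lebesgueS Hh => t Ht /= tD; apply: cvg_EFin.
      by apply: nearW.
    exact: (cvg_step_fun H a s_ ps mesh0 (Ht (sub_itv _ tD)) tD).
  - apply: measurable_bounded_integrable => //.
      rewrite [ltLHS]lebesgue_measure_itv/=; case: ifPn => // _.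
      by rewrite -EFinB ltry.
    by exists `|M|; split => // x x1 t _ /=; rewrite ltW.
  - apply: aeW => t n tD /=; rewrite lee_fin.
    exact: (step_fun_bounded H a HM (ps n)).
  split => //; rewrite /Rintegral.
  have -> : (fun n => \sum_(i < size (s_ n))
        H (node a (s_ n) i) (node a (s_ n) i.+1) *
        (node a (s_ n) i.+1 - node a (s_ n) i)) =
      fine \o (fun n => \int[lebesgue_measure]_(t in `]a, b])
        (step_fun H a (s_ n) t)%:E)%E.
    by apply/funext => n /=; rewrite (integral_step_fun H a (ps n)).
  apply: fine_cvg; rewrite fineK//.
  exact: integrable_fin_num.
have inv0 n : 0 < n.+1%:R^-1 :> R by rewrite invr_gt0.
(* Integrability of [h] is a by-product of dominated convergence along any one sequence of
   partitions; it allows the passage from []a, b]] to [[a, b]]. *)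
have ih : lebesgue_measure.-integrable `]a, b] (EFin \o h).
  have /choice[s_ s_P] n : exists s, itv_partition a b s /\
      mesh a s < n.+1%:R^-1.
    by have [s ? ?] := uniform_partition ab (inv0 n); exists s.
  by have [] := dct s_ (fun n => (s_P n).1) (fun n => (s_P n).2).
rewrite -Rintegral_itv_obnd_cbnd//; apply/cvgrPdist_lt => e e0.
apply: contrapT => far.
(* Failure at tolerance [e], tested with mesh bounds 1/(n+1), selects partitions whose sums all stay
   at distance at least [e], against [dct]. *)
have /choice[s_ s_P] n : exists s, [/\ itv_partition a b s,
    mesh a s < n.+1%:R^-1 & e <= `|\int[lebesgue_measure]_(t in `]a, b]) h t -
      \sum_(i < size s) H (node a s i) (node a s i.+1) *
        (node a s i.+1 - node a s i)|].
  apply: contrapT => none; apply: far; exists n.+1%:R^-1 => // s ps sn.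
  by rewrite ltNge; apply/negP => es; apply: none; exists s.
have [||_ /cvgrPdist_lt/(_ e e0)[n _ /(_ n (leqnn n))]] := dct s_.
- by move=> n; case: (s_P n).
- by move=> n; case: (s_P n).
- by rewrite /= ltNge; case: (s_P n) => _ _ ->.
Qed.

(** * Difference quotients and the signed sums *)

Lemma difference_quotient_derive1 {R : realType} {g : R -> R} {a b u v : R} :
  (forall x, x \in `[a, b] -> derivable g x 1) ->
  a <= u -> u < v -> v <= b ->
  exists2 x, u < x < v & (g v - g u) / (v - u) = derive1 g x.
Proof.
move=> dg au uv vb.
have sub x : u <= x <= v -> x \in `[a, b].
  by move=> /andP[ux xv]; rewrite in_itv/= (le_trans au)//= (le_trans xv).
have [||x] := @MVT _ g (derive1 g) _ _ uv.
- move=> x; rewrite in_itv/= => /andP[/ltW ux /ltW xv].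
  by rewrite derive1E; apply/derivableP/dg/sub; rewrite ux.
- apply: derivable_within_continuous => x; rewrite in_itv/= => uxv.
  exact/dg/sub.
rewrite in_itv/= => uxv ->; exists x => //.
by rewrite mulfK// subr_eq0 gt_eqF.
Qed.

(** The mean value point and [t] lie in the same cell, so they are closer than the cell length;
    continuity of the derivative relative to [[a, b]] concludes. *)
Lemma cvg_shrink_to_difference_quotient {R : realType} (g : R -> R)
    (a b t : R) :
  (forall x, x \in `[a, b] -> derivable g x 1) ->
  {within `[a, b], continuous (derive1 g)} -> t \in `[a, b] ->
  (g p.2 - g p.1) / (p.2 - p.1) @[p --> shrink_to a b t] --> derive1 g t.
Proof.
move=> dg cg tab; apply/cvgrPdist_lt => e e0.
have /subspace_continuousP/(_ t tab)/cvgrPdist_lt/(_ e e0) := cg.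
move=> /nbhs_ballP[d /= d0 dP]; exists d => // -[u v] [/= au ut tv vb uv].
have [x /andP[ux xv] ->] :=
  difference_quotient_derive1 dg au (lt_le_trans ut tv) vb.
apply: dP; last first.
  by rewrite /= in_itv/= (le_trans au (ltW ux)) (le_trans (ltW xv)).
by rewrite /ball/= ltr_norml; apply/andP; split; lra.
Qed.

Lemma cvg_shrink_to_fst {R : realType} (a b t : R) :
  p.1 @[p --> shrink_to a b t] --> t.
Proof.
apply/cvgrPdist_lt => e e0; exists e => // -[u v] [/= au ut tv vb uv].
by rewrite ltr_norml; apply/andP; split; lra.
Qed.

Lemma cvg_shrink_to_snd {R : realType} (a b t : R) :
  p.2 @[p --> shrink_to a b t] --> t.
Proof.
apply/cvgrPdist_lt => e e0; exists e => // -[u v] [/= au ut tv vb uv].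
by rewrite ltr_norml; apply/andP; split; lra.
Qed.

Lemma signed_sums_cvg {R : realType} (g f : R -> R) (a b d : R) (eps : sign) :
  a < b -> 0 <= d ->
  (forall x, x \in `[a, b] -> derivable g x 1) ->
  {within `[a, b], continuous (derive1 g)} ->
  measurable_fun setT f -> (forall x, 0 <= f x) ->
  (0 < d -> bounded_ae_continuous a b f) ->
  \sum_(i < size s) signed_part eps (g (node a s i.+1) - g (node a s i)) *
    f (node a s i.+1) `^ d * f (node a s i) `^ d @[s --> mesh_to0 a b] -->
  \int[lebesgue_measure]_(t in `[a, b])
    (signed_part eps (derive1 g t) * f t `^ (2 * d)).
Proof.
move=> ab d0 dg cg mf f0 hf.
(* [H u v] is the summand of the cell per unit length. *)
pose H u v := signed_part eps ((g v - g u) / (v - u)) * f v `^ d * f u `^ d.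
have [c _ cmax] : exists2 c, c \in `[a, b] &
    forall t, t \in `[a, b] -> `|derive1 g t| <= `|derive1 g c|.
  apply: (@EVT_max _ (fun x => `|derive1 g x|)); first exact: ltW.
  by move=> x; apply: cvg_norm; exact: cg.
(* For [d = 0] the powers are 1 and nothing is known of the density, hence the case split here and
   in [ae_f]. *)
have [M M0 fM] : exists2 M, 0 <= M & forall x, x \in `[a, b] -> f x `^ d <= M.
  move: d0; rewrite le_eqVlt => /predU1P[<-|d0].
    by exists 1 => // x _; rewrite powRr0.
  have [[M fM] _] := hf d0; have M0 : 0 <= M.
    by apply: le_trans (fM a _) => //; rewrite in_itv/= lexx ltW.
  exists (M `^ d) => [|x xab]; first exact: powR_ge0.
  rewrite ge0_ler_powR ?nnegrE ?(ltW d0)//.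
  by apply: le_trans (fM x xab); rewrite ler_norm.
have ae_f : {ae (@lebesgue_measure R), forall t, t \in `[a, b] ->
    f x `^ d @[x --> t] --> f t `^ d}.
  move: d0; rewrite le_eqVlt => /predU1P[<-|d0].
    apply: aeW => t _; under eq_fun do rewrite powRr0.
    by rewrite powRr0; exact: cvg_cst.
  apply: ae_lebesgueS (hf d0).2 => t ft tab.
  by apply: cvg_powR_base => //; [exact: ltW|exact: ft].
have := @interval_sums_cvg _ H
  (fun t => signed_part eps (derive1 g t) * f t `^ (2 * d)) a b
  (`|derive1 g c| * M * M) ab.
have HE s : itv_partition a b s ->
  \sum_(i < size s) H (node a s i) (node a s i.+1) *
    (node a s i.+1 - node a s i) =
  \sum_(i < size s) signed_part eps (g (node a s i.+1) - g (node a s i)) *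
    f (node a s i.+1) `^ d * f (node a s i) `^ d.
  move=> ps; apply: eq_bigr => i _.
  have dx : 0 < node a s i.+1 - node a s i by rewrite subr_gt0 (node_lt ps).
  (* The increment is divided and multiplied by the positive cell length, which then leaves the
     signed part by homogeneity. *)
  rewrite -[X in signed_part _ X](divfK (lt0r_neq0 dx)) signed_partM ?ltW//.
  by rewrite /H; ring.
move=> cvgH.
apply: cvg_trans; last apply: cvgH.
(* The two sums are compared on partitions only, where cells have positive length; the mesh bound 1
   is arbitrary. *)
- by apply: near_eq_cvg; exists 1 => // s ps _; rewrite HE.
- apply: measurable_funM.
    apply: measurable_signed_part.
    exact: subspace_continuous_measurable_fun.
  apply: (measurable_funS measurableT) => //.
  exact: (measurableT_comp (measurable_powR (2 * d)) mf).
- move=> u v au uv vb; rewrite /H.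
  have [x /andP[ux xv] ->] := difference_quotient_derive1 dg au uv vb.
  rewrite !normrM !(ger0_norm (powR_ge0 _ _)).
  apply: ler_pM; rewrite ?mulr_ge0 ?powR_ge0//.
    apply: ler_pM; rewrite ?powR_ge0//.
      apply: le_trans (norm_signed_part_le _ _ _) _; apply: cmax.
      by rewrite in_itv/= (le_trans au (ltW ux)) (le_trans (ltW xv)).
    by apply: fM; rewrite in_itv/= vb (le_trans au (ltW uv)).
  by apply: fM; rewrite in_itv/= au (le_trans (ltW uv)).
apply: ae_lebesgueS ae_f => t ft tab.
(* The exponent [2 * d] splits into one factor for each end of the cell; both ends tend to [t]. *)
have -> : f t `^ (2 * d) = f t `^ d * f t `^ d.
  by rewrite mulrC powRrM powR_mulrn ?powR_ge0// expr2.
rewrite mulrA; apply: cvgM; first apply: cvgM.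
- by apply: cvg_signed_part; exact: cvg_shrink_to_difference_quotient.
- exact: cvg_comp (cvg_shrink_to_snd a b t) (ft tab).
- exact: cvg_comp (cvg_shrink_to_fst a b t) (ft tab).
Qed.

Theorem theorem8p1 (R : realType) (disp : measure_display)
  (Omega : measurableType disp) (P : probability Omega R) (k : nat)
  (X Y : {RV P >-> R}) (Z : {RV P >-> k.-tuple R})
  (g g_in f : R -> k.-tuple R -> R) (a b d : R) (z : k.-tuple R)
  (hab : a < b)
  (hX : continuous_rv X)
  (hsupp : rv_support X `<=` `[a, b])
  (hY : forall w, Y w = g (X w) (Z w))
  (hg_in : interventional_of X Z g g_in)
  (hf : conditional_pdf X Z f)
  (hz : range Z z)
  (hd : 0 <= d)
  (hfz : 0 < d -> bounded_ae_continuous a b (fun x => f x z))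
  (hder : forall x, x \in `[a, b] -> derivable (fun t => g_in t z) x 1)
  (hcont : {within `[a, b], continuous (fun x => partial_x g_in x z)}) :
  forall eps : sign,
    cvg (L_sum g_in f d a z eps s @[s --> mesh_to0 a b]) /\
    PIEV g_in f d a b z eps =
      \int[lebesgue_measure]_(t in `[a, b])
        (signed_part eps (partial_x g_in t z) * f t z `^ (2 * d)).
Proof.
move=> eps; have [mf f0 _ _] := hf.
have mfz : measurable_fun setT (f^~ z) := measurable_fun_pair1 z mf.
(* Convergence comes first, since [lim] denotes a default value when there is no limit. *)
have cvgL : L_sum g_in f d a z eps s @[s --> mesh_to0 a b] -->
    \int[lebesgue_measure]_(t in `[a, b])
      (signed_part eps (partial_x g_in t z) * f t z `^ (2 * d)).
  exact: signed_sums_cvg.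
have pF := mesh_to0_proper R a b hab.
by split; [apply/cvg_ex; eexists; exact: cvgL|exact: cvg_lim].
Qed.
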